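(* Let $L$ be a lattice and let $p,q\in\mathrm{J}^{\mathrm c}(L)$. Then the following assertions hold: (i) If $L$ has the weak minimal join-cover refinement property, then $\Delta(p)\ll\Delta(q)$ implies that $p\vartriangleleft q$. (ii) If $L$ is join-semidistributive, then $p\vartriangleleft^{\mathrm c}q$ implies that $\Delta(p)\ll\Delta(q)$.
   Context: Let $L$ be a lattice. $L$ is join-semidistributive if $x\vee y=x\vee z$ implies $x\vee y=x\vee(y\wedge z)$. Put $L^-=L\setminus\{0\}$ if $L$ has a zero element $0$, and $L^-=L$ otherwise. $\mathrm{J}(L)$ is the set of join-irreducible elements ($p\in L^-$ such that $p=x\vee y$ implies $p\in\{x,y\}$), and $\mathrm{J}^{\mathrm c}(L)$ the set of completely join-irreducible elements ($p\in L^-$ such that there is a largest element $p_*$ strictly below $p$). The dimension monoid $\mathrm{Dim}\,L$ is the commutative monoid (with zero element $0$) defined by generators $\Delta(x,y)$, for $x\le y$ in $L$, and relations: $\Delta(x,x)=0$; $\Delta(x,z)=\Delta(x,y)+\Delta(y,z)$ for $x\le y\le z$; $\Delta(x\wedge y,x)=\Delta(y,x\vee y)$. For $p\in\mathrm{J}^{\mathrm c}(L)$, $\Delta(p)=\Delta(p_*,p)\in\mathrm{Dim}\,L$. In a commutative monoid, $x\ll y$ means $x+y=y$. Join-covers: for $a\in L^-$, a join-cover of $a$ is a nonempty finite $X\subseteq L^-$ with $a\le\bigvee X$; it is nontrivial if no $x\in X$ satisfies $a\le x$. $X\sqsubseteq Y$ ($X$ refines $Y$) means that every $x\in X$ is below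 some $y\in Y$. A nontrivial join-cover $X$ of $a$ is minimal if every nontrivial join-cover $Y$ of $a$ with $Y\sqsubseteq X$ contains $X$. $L$ has the weak minimal join-cover refinement property if for every $a\in L^-$, every nontrivial join-cover of $a$ can be refined to a minimal nontrivial join-cover of $a$. Join-dependency: for $a\in L$ and $q\in\mathrm{J}(L)$, $a\mathbin{D}q$ means that $a\ne q$ and there is $x\in L$ with $a\le q\vee x$ and $a\nleq y\vee x$ for all $y<q$. $\vartriangleleft$ is the transitive closure of $D$ on $\mathrm{J}(L)$, and $\vartriangleleft^{\mathrm c}$ is the transitive closure of the restriction of $D$ to $\mathrm{J}^{\mathrm c}(L)$. *)

(* Defs.v *)
From HB Require Import structures.
From Stdlib Require Import Relation_Operators.
From mathcomp Require Import all_boot all_order all_algebra.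
From mathcomp Require Import finmap.
From mathcomp Require Import boolp classical_sets.

Set Implicit Arguments.
Unset Strict Implicit.
Unset Printing Implicit Defensive.

Import Order.TTheory GRing.Theory.

Local Open Scope order_scope.
Local Open Scope quotient_scope.

Section Lattice.
Context {d : Order.disp_t} {L : latticeType d}.
Implicit Types (a p q x y z : L) (X Y : {fset L}).

Definition join_semidistributive :=
  forall x y z, x `|` y = x `|` z -> x `|` y = x `|` (y `&` z).

Definition is_zero x := forall y, x <= y.

(* Membership in $L^-$; if L has no zero, every element qualifies. *)
Definition nonzero x := ~ is_zero x.

Definition join_irreducible p :=
  nonzero p /\ forall x y, p = x `|` y -> p = x \/ p = y.

Definition is_lower_cover p x := x < p /\ forall y, y < p -> y <= x.

Definition completely_join_irreducible p :=
  nonzero p /\ exists x, is_lower_cover p x.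

(* This is $p_*$ when p is completely join-irreducible. When no largest
   element strictly below p exists, it is p itself. *)
Definition lower_cover p : L := xget p [set x | is_lower_cover p x].

Lemma lower_cover_le p : lower_cover p <= p.
Proof. by rewrite /lower_cover; case: xgetP => // x _ [/ltW]. Qed.

Lemma lower_coverP p :
  completely_join_irreducible p -> is_lower_cover p (lower_cover p).
Proof. by move=> [_ px]; exact: (@xgetPex _ p [set x | is_lower_cover p x]). Qed.

(* L need not have a zero, so the join is only defined for nonempty X. *)
Definition le_join a X : bool :=
  if (X : seq L) is x :: s then a <= foldr Order.join x s else false.

Definition join_cover a X :=
  [/\ X != fset0, (forall x, x \in X -> nonzero x) & le_join a X].

Definition nontrivial_join_cover a X :=
  join_cover a X /\ forall x, x \in X -> ~~ (a <= x).

Definition refines X Y :=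
  forall x, x \in X -> exists2 y, y \in Y & x <= y.

Definition minimal_join_cover a X :=
  nontrivial_join_cover a X /\
  forall Y, nontrivial_join_cover a Y -> refines Y X -> (X `<=` Y)%fset.

Definition weak_minimal_join_cover_refinement :=
  forall a, nonzero a -> forall X, nontrivial_join_cover a X ->
  exists2 Y, minimal_join_cover a Y & refines Y X.

(* The relation $a \mathbin{D} q$, for join-irreducible q. *)
Definition join_dep a q :=
  a <> q /\
  exists x, a <= q `|` x /\ forall y, y < q -> ~~ (a <= y `|` x).

Definition join_dep_on (P : L -> Prop) p q := [/\ P p, P q & join_dep p q].

Definition tri : L -> L -> Prop :=
  clos_trans L (join_dep_on join_irreducible).

Definition tri_c : L -> L -> Prop :=
  clos_trans L (join_dep_on completely_join_irreducible).

End Lattice.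

Arguments join_semidistributive {d} L.
Arguments weak_minimal_join_cover_refinement {d} L.

Section DimensionMonoid.
Context {d : Order.disp_t} (L : latticeType d).

Definition dim_gen := {xy : L * L | xy.1 <= xy.2}.

Definition mk_gen (x y : L) (xy : x <= y) : dim_gen :=
  exist (fun uv : L * L => uv.1 <= uv.2) (x, y) xy.

(* A word stands for the sum of its letters. *)
Definition dim_word := seq dim_gen.

(* Least commutative-monoid congruence containing the defining relations. *)
Inductive dim_cong : dim_word -> dim_word -> Prop :=
| dim_refl s : dim_cong s s
| dim_sym s t : dim_cong s t -> dim_cong t s
| dim_trans s t u : dim_cong s t -> dim_cong t u -> dim_cong s u
| dim_cat s1 s2 t1 t2 :
    dim_cong s1 t1 -> dim_cong s2 t2 -> dim_cong (s1 ++ s2) (t1 ++ t2)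
| dim_catC s t : dim_cong (s ++ t) (t ++ s)
| dim_diag x : dim_cong [:: mk_gen (lexx x)] [::]
| dim_chain x y z (xy : x <= y) (yz : y <= z) :
    dim_cong [:: mk_gen (le_trans xy yz)] [:: mk_gen xy; mk_gen yz]
| dim_persp x y : dim_cong [:: mk_gen (leIl x y)] [:: mk_gen (leUr y x)].

Definition dim_congb (s t : dim_word) : bool := `[< dim_cong s t >].

Lemma dim_congb_refl : reflexive dim_congb.
Proof. by move=> s; apply/asboolP; exact: dim_refl. Qed.

Lemma dim_congb_sym : symmetric dim_congb.
Proof. by move=> s t; apply/asboolP/asboolP; exact: dim_sym. Qed.

Lemma dim_congb_trans : transitive dim_congb.
Proof.
by move=> t s u /asboolP st /asboolP tu; apply/asboolP; exact: dim_trans st tu.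
Qed.

Canonical dim_congb_equiv :=
  EquivRel dim_congb dim_congb_refl dim_congb_sym dim_congb_trans.

Definition Dim := {eq_quot dim_congb}.
HB.instance Definition _ := Choice.on Dim.

Definition dim_zero : Dim := \pi_Dim [::].
Definition dim_add (u v : Dim) : Dim := \pi_Dim (repr u ++ repr v).

Lemma dim_eqP (s t : dim_word) : \pi_Dim s = \pi_Dim t <-> dim_cong s t.
Proof.
split; first by move=> /eqquotP /asboolP.
by move=> st; apply/eqquotP; apply/asboolP.
Qed.

Lemma dimW (P : Dim -> Prop) : (forall s, P (\pi_Dim s)) -> forall u, P u.
Proof. by move=> Ps; elim/quotW=> s; exact: Ps. Qed.

Lemma dim_add_pi (s t : dim_word) :
  dim_add (\pi_Dim s) (\pi_Dim t) = \pi_Dim (s ++ t).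
Proof. by apply/dim_eqP; apply: dim_cat; apply/dim_eqP; rewrite reprK. Qed.

Lemma dim_addA : associative dim_add.
Proof.
elim/dimW=> s; elim/dimW=> t; elim/dimW=> u.
by rewrite !dim_add_pi catA.
Qed.

Lemma dim_addC : commutative dim_add.
Proof.
elim/dimW=> s; elim/dimW=> t; rewrite !dim_add_pi.
by apply/dim_eqP; exact: dim_catC.
Qed.

Lemma dim_add0 : left_id dim_zero dim_add.
Proof. by elim/dimW=> s; rewrite dim_add_pi. Qed.

HB.instance Definition _ :=
  GRing.isNmodule.Build Dim dim_addA dim_addC dim_add0.

End DimensionMonoid.

Section Delta.
Context {d : Order.disp_t} {L : latticeType d}.

Definition Delta (x y : L) (xy : x <= y) : Dim L := \pi_(Dim L) [:: mk_gen xy].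

(* This is $\Delta(p)$ for completely join-irreducible p. *)
Definition Delta_ji (p : L) : Dim L := Delta (lower_cover_le p).

Lemma Delta_diag (x : L) (xx : x <= x) : Delta xx = 0%R.
Proof.
rewrite (bool_irrelevance xx (lexx x)).
by apply/dim_eqP; exact: dim_diag.
Qed.

Lemma Delta_chain (x y z : L) (xy : x <= y) (yz : y <= z) (xz : x <= z) :
  Delta xz = (Delta xy + Delta yz)%R.
Proof.
rewrite (bool_irrelevance xz (le_trans xy yz)).
by rewrite [RHS]dim_add_pi; apply/dim_eqP; exact: dim_chain.
Qed.

Lemma Delta_persp (x y : L) (h : x `&` y <= x) (k : y <= x `|` y) :
  Delta h = Delta k.
Proof.
rewrite (bool_irrelevance h (leIl x y)) (bool_irrelevance k (leUr y x)).
by apply/dim_eqP; exact: dim_persp.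
Qed.

Lemma Dim_universal (M : nmodType) (f : forall x y : L, x <= y -> M) :
  (forall x (xx : x <= x), f x x xx = 0%R) ->
  (forall x y z (xy : x <= y) (yz : y <= z) (xz : x <= z),
     f x z xz = (f x y xy + f y z yz)%R) ->
  (forall x y (h : x `&` y <= x) (k : y <= x `|` y), f _ _ h = f _ _ k) ->
  exists! g : Dim L -> M,
    [/\ g 0%R = 0%R, (forall u v, g (u + v)%R = (g u + g v)%R) &
        forall x y (xy : x <= y), g (Delta xy) = f x y xy].
Proof.
move=> f0 fD fP.
pose h (s : dim_word L) : M := (\sum_(e <- s) f _ _ (valP e))%R.
have h1 x y (xy : x <= y) : h [:: mk_gen xy] = f x y xy.
  by rewrite /h big_seq1; congr (f _ _ _); exact: bool_irrelevance.
have hcat s t : h (s ++ t) = (h s + h t)%R by rewrite /h big_cat.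
have hcong s t : dim_cong s t -> h s = h t.
  elim=> {s t} // [s t u _ -> _ -> //|s1 s2 t1 t2 _ e1 _ e2|s t|x|x y z xy yz|x y].
  - by rewrite !hcat e1 e2.
  - by rewrite !hcat addrC.
  - by rewrite h1 f0 /h big_nil.
  - by rewrite -[[:: _; _]]cat1s hcat !h1; exact: fD.
  - by rewrite !h1; exact: fP.
have hrepr s : h (repr (\pi_(Dim L) s)) = h s.
  by apply: hcong; apply/dim_eqP; rewrite reprK.
exists (fun u => h (repr u)); split.
  split; first by rewrite [LHS]hrepr /h big_nil.
  - by move=> u v; rewrite [LHS]hrepr hcat.
  - by move=> x y xy; rewrite [LHS]hrepr h1.
move=> g [g0 gD gf]; apply/funext; apply: dimW => s; rewrite hrepr.
elim: s => [|[[x y] /= xy] s IH]; first by rewrite /h big_nil; exact/esym.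
rewrite -cat1s hcat IH -dim_add_pi (gD (\pi_(Dim L) _) (\pi_(Dim L) s)).
by congr (_ + _)%R; rewrite -[LHS]/(h [:: mk_gen xy]) h1 -gf.
Qed.

End Delta.

(* The relation $u \ll v$. *)
Definition absorbed (M : nmodType) (u v : M) := (u + v = v)%R.

(* Main.v *)
Require Import Defs.
From Stdlib Require Import Relation_Operators.
From mathcomp Require Import all_boot all_order.
From mathcomp Require Import ssralg finmap boolp.

(** (i) Let S be the set of all r with p <| r.  Because minimal join-covers
    consist of join-irreducibles on which the covered element D-depends, "some
    r in S lies below y but not below x" is invariant under perspectivity of
    intervals [[x, y]], and so is "p lies below y but not below x" on the
    intervals not separated by S.  Counting the latter gives a map from Dim L
    to {0, 1, 2, ...} with an infinite element, nonzero at Delta(p), and finite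
    at Delta(q) unless p <| q.
    (ii) Since absorption is transitive, it suffices to treat p D q.  If z
    contains q_* and witnesses p D q, then Delta(q) = Delta(z, z \/ q), and this
    interval contains z \/ p.  If p <= z \/ p_*, then Delta(p) is absorbed
    already by Delta(p /\ z, p_* ), a summand of Delta(q).  Otherwise
    join-semidistributivity forces z \/ p < z \/ q; replacing z by w = z \/ p_*,
    we get Delta(w, w \/ p) = Delta(p) and Delta(w \/ p, w \/ q) = Delta(q). *)

Set Implicit Arguments.
Unset Strict Implicit.
Unset Printing Implicit Defensive.

Import Order.TTheory GRing.Theory.
Local Open Scope order_scope.

(** * Minimal join-covers and join-dependency *)

Section MinimalJoinCovers.
Context {d : Order.disp_t} {L : latticeType d}.
Implicit Types (a b p q r s x y z : L) (X Y : {fset L}).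

Lemma foldr_join_le x (t : seq L) b :
  (foldr Order.join x t <= b) = all (fun y => y <= b) (x :: t).
Proof.
by elim: t => [|y t IH] /=; rewrite ?andbT // leUx IH /= andbCA.
Qed.

(** Together with [le_joinP] this replaces the fold in [le_join] by upper bounds, so the enumeration
    of [X] no longer matters. *)
Lemma fset_lub X : X != fset0 ->
  exists x, forall b, x <= b <-> {in X, forall y, y <= b}.
Proof.
case E : (X : seq L) => [|x t] X0.
  by case/fset0Pn: X0 => y; rewrite -[_ \in _]/(y \in (X : seq L)) E.
exists (foldr Order.join x t) => b; rewrite foldr_join_le -E.
by split=> [/allP|] h; [|apply/allP].
Qed.

Lemma le_joinP a X : X != fset0 ->
  le_join a X <-> (forall b, {in X, forall y, y <= b} -> a <= b).
Proof.
move=> X0; rewrite /le_join; case E : (X : seq L) => [|x t].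
  by case/fset0Pn: X0 => y; rewrite -[_ \in _]/(y \in (X : seq L)) E.
split=> [ax b hb|]; last first.
  apply=> y yX; move: (lexx (foldr Order.join x t)).
  by rewrite foldr_join_le -E => /allP; apply.
by apply: le_trans ax _; rewrite foldr_join_le -E; apply/allP.
Qed.

(* Minimality forbids replacing s in X by finitely many elements below s. *)
Lemma minimal_join_cover_split a X s : minimal_join_cover a X -> s \in X ->
  exists2 x, a <= s `|` x
    & forall Y, {in Y, forall y, y < s} ->
      exists b, [/\ x <= b, {in Y, forall y, y <= b} & ~~ (a <= b)].
Proof.
move=> [[[X0 Xn /(le_joinP _ X0) aX] Xt] Xm] sX.
(* If [s] were the only member of [X], then [a <= s], against nontriviality. *)
have X's0 : (X `\ s)%fset != fset0.
  apply/negP => /eqP X's; have /negP := Xt _ sX; apply.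
  apply: aX => y yX; case: (eqVneq y s) => [-> //|ys].
  by have := in_fset0 y; rewrite -X's in_fsetD1 ys yX.
have [x xl] := fset_lub X's0; exists x => [|Y Ys].
  apply: aX => y yX; case: (eqVneq y s) => [->|ys]; first exact: leUl.
  by apply: le_trans (leUr _ _); have /xl := lexx x; apply; rewrite in_fsetD1 ys.
apply: contrapT => noB.
(* Members of a join-cover are nonzero, so a zero is dropped from [Y]. Without a bound [b], the set
   [Z] would be a nontrivial join-cover refining [X], and minimality would put [s] in [Z]. *)
pose Y' := [fset y in Y | `[< nonzero y >]]%fset.
pose Z := (X `\ s `|` Y')%fset.
have ZX y : y \in Z -> nonzero y /\ (y \in X \/ y < s).
  rewrite in_fsetU in_fsetD1 => /orP[/andP[_ yX]|].
    by split; [exact: Xn|left].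
  by rewrite !inE /= => /andP[/Ys ys /asboolP yn]; split=> //; right.
have Z0 : Z != fset0.
  by case/fset0Pn: X's0 => y yX; apply/fset0Pn; exists y; rewrite in_fsetU yX.
have /fsubsetP/(_ s sX) : (X `<=` Z)%fset.
  apply: Xm; first split; first split=> //.
  - by move=> y /ZX[].
  - apply/(le_joinP _ Z0) => b hb; apply: contrapT => /negP ab; apply: noB.
    exists b; split=> //.
      by apply/xl => y yX; apply: hb; rewrite in_fsetU yX.
    move=> y yY; have [|yn] := asboolP (is_zero y); first exact.
    by apply: hb; rewrite in_fsetU !inE /= yY asboolT ?orbT.
  - move=> y /ZX[_ [|ys]]; first exact: Xt.
    by apply: contra (Xt _ sX) => ay; exact: le_trans ay (ltW ys).
  - move=> y /ZX[_ [yX|ys]]; first by exists y.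
    by exists s => //; exact: ltW.
by rewrite in_fsetU in_fsetD1 eqxx !inE /= => /andP[/Ys]; rewrite ltxx.
Qed.

(** If [s = u \/ v] with [u] and [v] strictly below [s], these two could replace [s] in the
    cover. *)
Lemma minimal_join_cover_irreducible a X s :
  minimal_join_cover a X -> s \in X -> join_irreducible s.
Proof.
move=> aX sX; have [[[_ Xn _] _] _] := aX; split=> [|u v suv]; first exact: Xn.
apply: contrapT => /not_orP[su sv].
have [x asx /(_ [fset u; v]%fset) []] := minimal_join_cover_split aX sX.
  move=> y; rewrite !inE lt_neqAle suv => /orP[]/eqP ->.
    by rewrite leUl -suv andbT; apply/eqP => us; exact: su.
  by rewrite leUr -suv andbT; apply/eqP => vs; exact: sv.
move=> b [xb uvb /negP]; apply; apply: le_trans asx _.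
by rewrite leUx xb suv leUx !uvb // !inE eqxx ?orbT.
Qed.

(** The join of the other members of [X] witnesses the dependency. *)
Lemma minimal_join_cover_dep a X s :
  minimal_join_cover a X -> s \in X -> join_dep a s.
Proof.
move=> aX sX; have [[_ Xt] _] := aX; split.
  by move=> as_; have := Xt _ sX; rewrite as_ lexx.
have [x asx Ys] := minimal_join_cover_split aX sX.
exists x; split=> // y ys.
have [|b [xb yb ab]] := Ys [fset y]%fset; first by move=> z; rewrite inE => /eqP ->.
apply: contra ab => ayx; apply: le_trans ayx _.
by rewrite leUx xb yb // inE.
Qed.

(** Refine [{x, y}] to a minimal cover of [r]. Its members cannot all lie below [y], and one that
    does not must lie below [x]. *)
Lemma join_dep_below_summand r x y :
  weak_minimal_join_cover_refinement L -> join_irreducible r ->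
  r <= x `|` y -> ~~ (r <= x) -> ~~ (r <= y) ->
  exists s, [/\ join_dep_on join_irreducible r s, s <= x & ~~ (s <= y)].
Proof.
move=> wL rJ rxy rx ry.
have X0 : [fset x; y]%fset != fset0.
  by apply/fset0Pn; exists x; rewrite !inE eqxx.
have [||X rX Xxy] := wL r _ [fset x; y]%fset; first by case: rJ.
  split; first split=> //.
  - move=> z; rewrite !inE => /orP[]/eqP-> z0.
      by case/negP: ry; rewrite (le_trans rxy) // leUx lexx z0.
    by case/negP: rx; rewrite (le_trans rxy) // leUx lexx z0.
  - apply/(le_joinP _ X0) => b hb; apply: le_trans rxy _.
    by rewrite leUx !hb // !inE eqxx ?orbT.
  - by move=> z; rewrite !inE => /orP[]/eqP->.
have [[[X1 _ /(le_joinP _ X1) rX1] _] _] := rX.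
apply: contrapT => noS; move/negP: ry; apply; apply: rX1 => s sX.
have [z zxy sz] := Xxy _ sX; apply: contrapT => /negP sy; apply: noS.
exists s; split=> //.
  split=> //; first exact: minimal_join_cover_irreducible rX sX.
  exact: minimal_join_cover_dep rX sX.
move: zxy sz; rewrite !inE => /orP[]/eqP-> //.
by rewrite (negPf sy).
Qed.

End MinimalJoinCovers.

(** * An invariant of the dimension congruence *)

Section SeparationInvariant.
Context {d : Order.disp_t} {L : latticeType d}.
Implicit Types (p r s x y z : L) (e : dim_gen L).

Definition separates r e := (r <= (val e).2) && ~~ (r <= (val e).1).

Definition separated_by (S : L -> Prop) e :=
  `[< exists2 r, S r & separates r e >].

(** A word with a letter separated by [S] stands for the infinite value, so its count is left
    unconstrained. The element [p] is listed beside [S] because it need not belong to [S]. *)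
Lemma dim_cong_separates (S : L -> Prop) p :
  (forall r x y, S r \/ r = p ->
     r <= x `|` y -> ~~ (r <= x) -> ~~ (r <= y) ->
     exists s, [/\ S s, s <= x & ~~ (s <= y)]) ->
  forall u v : dim_word L, dim_cong u v ->
  has (separated_by S) u = has (separated_by S) v /\
  (~~ has (separated_by S) u ->
   count (separates p) u = count (separates p) v).
Proof.
move=> Sp u v; elim=> {u v} [//|u v _ [e1 e2]|u v w _ [e1 e2] _ [e3 e4]
    |u1 u2 v1 v2 _ [e1 e2] _ [e3 e4]|u v|x|x y z xy yz|x y].
- by split=> [//|uS]; rewrite e2 // e1.
- by split=> [|uS]; [rewrite e1|rewrite e2 // e4 // -e1].
- rewrite !has_cat !count_cat e1 e3; split=> // /norP[uS vS].
  by rewrite e2 ?e4 // (e1, e3).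
- by rewrite !has_cat !count_cat orbC addnC.
- have xx r : separates r (mk_gen (lexx x)) = false.
    by rewrite /separates andbN.
  rewrite /= xx; split=> //; rewrite orbF; apply/asboolP => -[r _].
  by rewrite xx.
(* If [r] separates [x] from [z], it separates exactly one of the two pieces, according to whether
   [r <= y]. *)
- have sepD r : (separates r (mk_gen (le_trans xy yz)) : nat) =
      (separates r (mk_gen xy) + separates r (mk_gen yz))%N.
    rewrite /separates /=; case ry: (r <= y).
      by rewrite (le_trans ry yz) andbF addn0.
    have -> : r <= x = false by apply: contraFF ry => rx; exact: le_trans xy.
    by [].
  rewrite /= !addn0 !orbF sepD; split=> //.
  have sepO r : separates r (mk_gen (le_trans xy yz)) =
      separates r (mk_gen xy) || separates r (mk_gen yz).
    by move: (sepD r); do 3!case: (separates _ _).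
  rewrite -asbool_or; apply: asbool_equiv_eq; split=> [[r rS]|].
    by rewrite sepO => /orP[]; [left|right]; exists r.
  by move=> [] [r rS rxy]; exists r => //; rewrite sepO rxy ?orbT.
- have sepl r : separates r (mk_gen (leIl x y)) -> separates r (mk_gen (leUr y x)).
    rewrite /separates /= lexI => /andP[rx]; rewrite rx /= => -> .
    by rewrite (le_trans rx) ?leUl.
  (* The converse can fail for [r] itself, but only when [r] is not below [x]; then some [s] in [S]
     separates the lower interval instead. *)
  have sepr r : S r \/ r = p -> separates r (mk_gen (leUr y x)) ->
      separates r (mk_gen (leIl x y)) \/ separated_by S (mk_gen (leIl x y)).
    rewrite /separates /= => rS /andP[rxy ry].
    have [rx|rx] := boolP (r <= x); first by left; rewrite lexI rx.
    right; apply/asboolP; have [s [sS sx sy]] := Sp _ _ _ rS rxy rx ry.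
    by exists s => //; rewrite /separates /= lexI sx.
  rewrite /= !orbF !addn0; split=> [|nS].
    apply/asboolP/asboolP => -[r rS rxy]; first by exists r => //; exact: sepl.
    by have [|/asboolP//] := sepr r (or_introl rS) rxy; exists r.
  congr nat_of_bool; apply/idP/idP => [|ps]; first exact: sepl.
  by have [//|] := sepr p (or_intror erefl) ps; rewrite (negPf nS).
Qed.

End SeparationInvariant.

(** * Absorption between completely join-irreducible elements *)

Section CompletelyJoinIrreducible.
Context {d : Order.disp_t} {L : latticeType d}.
Implicit Types (p q x y z : L).

Lemma lower_cover_lt p : completely_join_irreducible p -> lower_cover p < p.
Proof. by case/lower_coverP. Qed.

Lemma lt_le_lower_cover p x :
  completely_join_irreducible p -> x < p -> x <= lower_cover p.
Proof. by case/lower_coverP => _; apply. Qed.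

Lemma completely_join_irreducibleW p :
  completely_join_irreducible p -> join_irreducible p.
Proof.
move=> pJ; split=> [|x y pxy]; first by case: pJ.
apply: contrapT => /not_orP[/eqP px /eqP py].
have xp : x < p by rewrite lt_neqAle eq_sym px pxy leUl.
have yp : y < p by rewrite lt_neqAle eq_sym py pxy leUr.
have := lower_cover_lt pJ; rewrite lt_leAnge => /andP[_ /negP]; apply.
by rewrite {1}pxy leUx !lt_le_lower_cover.
Qed.

Lemma absorbed_tri p q :
  completely_join_irreducible p -> completely_join_irreducible q ->
  weak_minimal_join_cover_refinement L ->
  absorbed (Delta_ji p) (Delta_ji q) -> tri p q.
Proof.
move=> pJ qJ wL; rewrite /absorbed [LHS]dim_add_pi => /dim_eqP pq.
apply: contrapT => ntri.
have [|_] := @dim_cong_separates _ _ (tri p) p _ _ _ (dim_sym pq).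
  move=> r x y pr rxy rx ry.
  have rJ : join_irreducible r.
    case: pr => [|->]; last exact: completely_join_irreducibleW.
    by elim=> // ? ? [].
  have [s [rs sx sy]] := join_dep_below_summand wL rJ rxy rx ry.
  exists s; split=> //; case: pr => [pr|pr].
    exact: t_trans pr (t_step _ _ _ _ rs).
  by apply: t_step; rewrite -pr.
rewrite /= orbF /separated_by.
case: asboolP => [[r rS /andP[/= rq rq']] _|_ /(_ isT)].
  (* Every element strictly below [q] is below [lower_cover q], so [r] can only be [q]. *)
  have [rq_|rq_] := eqVneq r q; first by apply: ntri; rewrite -rq_.
  by rewrite lt_le_lower_cover // lt_neqAle rq_ in rq'.
have -> : separates p (mk_gen (lower_cover_le p)) = true.
  by rewrite /separates /= lexx (lt_geF (lower_cover_lt pJ)).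
(* Equality of the counts of [p] in the two words now reads 0 = 1. *)
by move/eqP; rewrite -[X in X == _]add0n eqn_add2r.
Qed.

(** The hypotheses give [q /\ z = lower_cover q], which makes the two intervals perspective. *)
Lemma Delta_ji_persp q z (zq : z <= z `|` q) :
  completely_join_irreducible q -> lower_cover q <= z -> ~~ (q <= z) ->
  Delta_ji q = Delta zq.
Proof.
move=> qJ qz nqz; rewrite /Delta_ji; move: (lower_cover_le q).
have -> : lower_cover q = q `&` z.
  apply/le_anti; rewrite lexI lower_cover_le qz /=.
  by rewrite lt_le_lower_cover // lt_neqAle leIl eq_meetl nqz.
by move: zq; rewrite joinC => zq h; exact: Delta_persp.
Qed.

Lemma join_dep_absorbed p q :
  completely_join_irreducible p -> completely_join_irreducible q ->
  join_semidistributive L -> join_dep p q ->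
  absorbed (Delta_ji p) (Delta_ji q).
Proof.
move=> pJ qJ sdL [/eqP npq [x [pqx px]]].
pose z := lower_cover q `|` x.
(* This is the witness condition of [join_dep] at [y = lower_cover q]. *)
have npz : ~~ (p <= z) by exact: px (lower_cover_lt qJ).
have q_z : lower_cover q <= z by exact: leUl.
have pzq : p <= z `|` q.
  by apply: le_trans pqx _; rewrite leUx leUr /z -joinA joinCA leUl.
have nqz : ~~ (q <= z).
  by apply: contra npz => qz; rewrite (le_trans pzq) // leUx lexx.
rewrite /absorbed; clearbody z => {x px pqx}.
have [pz|npz_] := boolP (p <= z `|` lower_cover p).
  (* Here [p /\ z, p_*] is perspective to [z, z \/ p], like [p /\ z, p], so
     Delta(p) is absorbed by Delta(p /\ z, p_* ). *)
  have pIz : p `&` z = lower_cover p `&` z.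
    apply/le_anti; rewrite !lexI !leIr (le_trans (leIl _ _) (lower_cover_le p)).
    by rewrite !andbT lt_le_lower_cover // lt_neqAle leIl eq_meetl npz.
  have e1 : z `|` p = z `|` lower_cover p.
    apply/le_anti; rewrite !leUx !leUl pz /=.
    by rewrite (le_trans (lower_cover_le p)) ?leUr.
  have zzp := leUl z p; have zpzq : z `|` p <= z `|` q by rewrite leUx leUl.
  have pIzp_ : p `&` z <= lower_cover p by rewrite pIz leIl.
  have e2 : Delta zzp = Delta pIzp_.
    move: zzp pIzp_ => {zpzq}; rewrite e1 pIz joinC => h k.
    exact/esym/Delta_persp.
  have e3 : Delta zzp = (Delta pIzp_ + Delta_ji p)%R.
    rewrite -(Delta_chain _ _ (leIl p z)).
    by move: zzp {e2}; rewrite joinC => h; exact/esym/Delta_persp.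
  rewrite (Delta_ji_persp (leUl z q) qJ q_z nqz) (Delta_chain zzp zpzq).
  by rewrite addrA; congr (_ + _)%R; rewrite {1}e2 e3 addrC.
have [qzp|nqzp] := boolP (q <= z `|` p).
  have zpq : z `|` p = z `|` q by apply/le_anti; rewrite !leUx !leUl pzq qzp.
  (* Otherwise [p /\ q <= lower_cover q <= z], and semidistributivity collapses [z \/ p] to [z]. *)
  have qp : q <= p.
    apply: contraNT npz => nqp.
    have /join_idPl pqz : p `&` q <= z.
      apply: le_trans q_z; apply: lt_le_lower_cover => //.
      by rewrite lt_neqAle leIr eq_meetr nqp.
    by rewrite -pqz -(sdL _ _ _ zpq) leUr.
  case/negP: npz_; apply: le_trans pzq _; rewrite leUx leUl /=.
  by rewrite (le_trans _ (leUr _ _)) // lt_le_lower_cover // lt_neqAle eq_sym npq.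
pose w := z `|` lower_cover p.
have zw : z <= w by exact: leUl.
have p_w : lower_cover p <= w by exact: leUr.
have wzp : w <= z `|` p.
  by rewrite leUx leUl (le_trans (lower_cover_le p)) ?leUr.
have npw : ~~ (p <= w) by [].
clearbody w.
have wpq : w `|` q = w `|` p `|` q.
  rewrite joinAC; apply/esym/join_idPl.
  by apply: le_trans pzq _; rewrite leUx leUr (le_trans zw) ?leUl.
have wpwq : w `|` p <= w `|` q by rewrite wpq leUl.
have q_w : lower_cover q <= w by exact: le_trans zw.
have nqwp : ~~ (q <= w `|` p).
  by apply: contra nqzp => qwp; rewrite (le_trans qwp) // leUx wzp leUr.
have nqw : ~~ (q <= w) by apply: contra nqwp => qw; rewrite (le_trans qw) ?leUl.
have e : Delta_ji q = Delta wpwq.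
  move: wpwq; rewrite wpq => wpwq; apply: Delta_ji_persp => //.
  by rewrite (le_trans q_w) ?leUl.
(* The intervals from [w \/ p] and from [w] up to [w \/ q] both have dimension [Delta_ji q]; they
   differ by the one from [w] to [w \/ p]. *)
rewrite {1}e (Delta_ji_persp (leUl w p) pJ p_w npw).
by rewrite -(Delta_chain _ _ (leUl w q)) -Delta_ji_persp.
Qed.

Lemma tri_c_absorbed p q : join_semidistributive L -> tri_c p q ->
  absorbed (Delta_ji p) (Delta_ji q).
Proof.
move=> sdL; elim=> {p q} [p q [pJ qJ pq]|p r q _ pr _ rq].
  exact: join_dep_absorbed.
by rewrite /absorbed -rq addrA pr.
Qed.

End CompletelyJoinIrreducible.

Theorem corollary4p3 (d : Order.disp_t) (L : latticeType d) (p q : L)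
    (hp : completely_join_irreducible p) (hq : completely_join_irreducible q) :
  (weak_minimal_join_cover_refinement L ->
     absorbed (Delta_ji p) (Delta_ji q) -> tri p q) /\
  (join_semidistributive L ->
     tri_c p q -> absorbed (Delta_ji p) (Delta_ji q)).
Proof. by split; [exact: absorbed_tri|exact: tri_c_absorbed]. Qed.
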